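(* Let $U=\begin{pmatrix} A_{U} & B_{U}\\ C_{U} & D_{U}\end{pmatrix}$ and $V=\begin{pmatrix} A_{V} & B_{V}\\ C_{V} & D_{V}\end{pmatrix}$ be complex block matrices of the same size, partitioned in the same way, with $A_U,A_V\in\mathbb{C}^{m\times n}$, $B_U,B_V\in\mathbb{C}^{m\times p}$, $C_U,C_V\in\mathbb{C}^{s\times n}$, $D_U,D_V\in\mathbb{C}^{s\times p}$. Suppose that $R(C_{U}^* )\subseteq R(A_{U}^* )$, $R(B_{U})\subseteq R(A_{U})$, $R(B_{U}^* )\subseteq R(D_{U}^* )$, $R(C_{U})\subseteq R(D_{U})$, $R(C_{V}^* )\subseteq R(A_{V}^* )$, $R(B_{V})\subseteq R(A_{V})$, $R(B_{V}^* )\subseteq R(D_{V}^* )$ and $R(C_{V})\subseteq R(D_{V})$. (i) Suppose that $A_{U}$ and $A_{V}$ are (square and) range symmetric. If $(U,V)$ is a Moore-Penrose inverse absorbing pair, then $(H_{U},H_{V})$ is also a Moore-Penrose inverse absorbing pair, where $$H_{U}=\begin{pmatrix} A_{U}^\dagger & -A_{U}^\dagger B_{U}\\ C_{U}A_{U}^\dagger & F_{U}\end{pmatrix},\quad H_{V}=\begin{pmatrix} A_{V}^\dagger & -A_{V}^\dagger B_{V}\\ C_{V}A_{V}^\dagger & F_{V}\end{pmatrix},$$ with $F_{U}=D_{U}-C_{U}A_{U}^\dagger B_{U}$ and $F_{V}=D_{V}-C_{V}A_{V}^\dagger B_{V}$. (ii) Suppose that $D_{U}$ and $D_{V}$ are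 (square and) range symmetric. If $(U,V)$ is a Moore-Penrose inverse absorbing pair, then $(J_{U},J_{V})$ is also a Moore-Penrose inverse absorbing pair, where $$J_{U}=\begin{pmatrix} G_{U} & B_{U}D_{U}^\dagger \\ -D_{U}^\dagger C_{U} & D_{U}^\dagger\end{pmatrix},\quad J_{V}=\begin{pmatrix} G_{V} & B_{V}D_{V}^\dagger \\ -D_{V}^\dagger C_{V} & D_{V}^\dagger\end{pmatrix},$$ with $G_{U}=A_{U}-B_{U}D_{U}^\dagger C_{U}$ and $G_{V}=A_{V}-B_{V}D_{V}^\dagger C_{V}$.
   Context: $R(X)$ denotes the range (column space) of a matrix $X$ and $X^*$ its conjugate transpose. $X^\dagger$ denotes the Moore-Penrose inverse of $X$, i.e. the unique matrix $Y$ with $XYX=X$, $YXY=Y$, $(XY)^*=XY$, $(YX)^*=YX$. A square matrix $X$ is range symmetric if $R(X^* )=R(X)$. For complex matrices $P,Q$ of the same size, the pair $(P,Q)$ is called a Moore-Penrose inverse absorbing pair if $P^\dagger+Q^\dagger=P^\dagger(P+Q)Q^\dagger$. $H_U$ is called the pseudo principal pivot transform of $U$ relative to $A_U$, and $J_U$ the complementary pseudo principal pivot transform of $U$ relative to $D_U$ (similarly for $V$). *)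

(* Defs.v *)
From HB Require Import structures.
From mathcomp Require Import all_boot all_order all_algebra.
From mathcomp Require Export sesquilinear spectral.

Set Implicit Arguments.
Unset Strict Implicit.
Unset Printing Implicit Defensive.

Import Order.TTheory GRing.Theory Num.Theory.
Local Open Scope ring_scope.
Local Open Scope sesquilinear_scope.

Section MoorePenrose.
Variable C : numClosedFieldType.
Implicit Types m n : nat.

(* Boolean, so that the inverse can be extracted by [xchoose]. *)
Definition is_mpinv m n (X : 'M[C]_(m, n)) (Y : 'M[C]_(n, m)) : bool :=
  [&& X *m Y *m X == X, Y *m X *m Y == Y,
      (X *m Y)^t* == X *m Y & (Y *m X)^t* == Y *m X].

Lemma trmxC_mul m n p (A : 'M[C]_(m, n)) (B : 'M[C]_(n, p)) :
  (A *m B)^t* = B^t* *m A^t*.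
Proof. by rewrite trmx_mul map_mxM. Qed.

Lemma mulmx_trmxC_eq0 m n (A : 'M[C]_(m, n)) : A *m A^t* = 0 -> A = 0.
Proof.
move=> A0; apply/matrixP => i j; rewrite mxE.
have : (A *m A^t*) i i = 0 by rewrite A0 mxE.
rewrite mxE => /psumr_eq0P /= S0.
have : A i j * (A^t*) j i = 0.
  by apply: S0 => // k _; rewrite !mxE mul_conjC_ge0.
by rewrite !mxE => /eqP; rewrite mul_conjC_eq0 => /eqP.
Qed.

Lemma gram_unitmx r n (B : 'M[C]_(r, n)) : row_free B -> B *m B^t* \in unitmx.
Proof.
move=> fB; rewrite -row_free_unit; apply/inj_row_free => v v0.
have vB0 : v *m B = 0.
  by apply: mulmx_trmxC_eq0; rewrite trmxC_mul mulmxA -(mulmxA v) v0 mul0mx.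
by apply: (row_free_inj fB); rewrite mul0mx.
Qed.

(* From a full-rank factorization X = L R, the Moore-Penrose inverse is
   R^* (R R^* )^-1 (L^* L)^-1 L^*. *)
Lemma mpinv_exists m n (X : 'M[C]_(m, n)) : exists Y, is_mpinv X Y.
Proof.
have [r [L [R [fL fR XE]]]] : exists r (L : 'M[C]_(m, r)) (R : 'M[C]_(r, n)),
    [/\ row_full L, row_free R & X = L *m R].
  exists (\rank X), (col_base X), (row_base X).
  by rewrite col_base_full row_base_free mulmx_base.
have uR : R *m R^t* \in unitmx by apply: gram_unitmx.
have uL : L^t* *m L \in unitmx.
  rewrite -{2}(trmxCK L); apply: gram_unitmx.
  by rewrite /row_free mxrank_map mxrank_tr.
set S := invmx (R *m R^t*); set T := invmx (L^t* *m L).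
have RS : R *m (R^t* *m S) = 1%:M by rewrite mulmxA mulmxV.
have TL : T *m L^t* *m L = 1%:M by rewrite -mulmxA mulVmx.
have hS : S^t* = S by rewrite /S trmx_inv map_invmx trmxC_mul trmxCK.
have hT : T^t* = T by rewrite /T trmx_inv map_invmx trmxC_mul trmxCK.
exists (R^t* *m S *m (T *m L^t*)); set Y := _ *m (T *m _).
have XY : X *m Y = L *m (T *m L^t*).
  by rewrite XE /Y -mulmxA (mulmxA R) RS mul1mx.
have YX : Y *m X = R^t* *m S *m R.
  by rewrite XE /Y -mulmxA (mulmxA _ L R) TL mul1mx.
apply/and4P; split; apply/eqP.
- by rewrite XY XE -mulmxA (mulmxA _ L R) TL mul1mx.
- by rewrite YX /Y -mulmxA (mulmxA R) RS mul1mx.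
- by rewrite XY !trmxC_mul trmxCK hT mulmxA.
- by rewrite YX !trmxC_mul trmxCK hS mulmxA.
Qed.

Lemma is_mpinv_uniq m n (X : 'M[C]_(m, n)) (Y Z : 'M[C]_(n, m)) :
  is_mpinv X Y -> is_mpinv X Z -> Y = Z.
Proof.
move=> /and4P[/eqP Y1 /eqP Y2 /eqP Y3 /eqP Y4].
move=> /and4P[/eqP Z1 /eqP Z2 /eqP Z3 /eqP Z4].
have XYZ : X *m Y = X *m Z.
  by rewrite -{1}Z1 -mulmxA -{1}Z3 -{1}Y3 -trmxC_mul mulmxA Y1 Z3.
have YZX : Y *m X = Z *m X.
  by rewrite -{1}Z1 -mulmxA mulmxA -Y4 -{1}Z4 -trmxC_mul -mulmxA (mulmxA X) Y1 Z4.
by rewrite -Y2 YZX -mulmxA XYZ mulmxA Z2.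
Qed.

Definition mpinv m n (X : 'M[C]_(m, n)) : 'M[C]_(n, m) :=
  xchoose (mpinv_exists X).

Lemma mpinvP m n (X : 'M[C]_(m, n)) : is_mpinv X (mpinv X).
Proof. exact: xchooseP. Qed.

Lemma mpinv_unique m n (X : 'M[C]_(m, n)) Y : is_mpinv X Y -> Y = mpinv X.
Proof. by move=> XY; apply: is_mpinv_uniq XY (mpinvP X). Qed.

(* Column space; MathComp's %MS operations are about row spaces. *)
Definition mxrange m n (X : 'M[C]_(m, n)) : {vspace 'cV[C]_m} :=
  limg (linfun (mulmx X : 'cV[C]_n -> 'cV[C]_m)).

Lemma mem_mxrangeP m n (X : 'M[C]_(m, n)) (y : 'cV[C]_m) :
  reflect (exists x : 'cV[C]_n, y = X *m x) (y \in mxrange X).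
Proof.
apply: (iffP memv_imgP) => [[x _ ->]|[x ->]]; exists x.
- by rewrite lfunE.
- exact: memvf.
- by rewrite lfunE.
Qed.

Definition range_symmetric n (X : 'M[C]_n) : Prop := mxrange (X^t*) = mxrange X.

Definition mp_absorbing m n (P Q : 'M[C]_(m, n)) : Prop :=
  mpinv P + mpinv Q = mpinv P *m (P + Q) *m mpinv Q.

(* Pseudo principal pivot transform of [A, B; C0, D] relative to A. *)
Definition pppt m n s p (A : 'M[C]_(m, n)) (B : 'M[C]_(m, p))
    (C0 : 'M[C]_(s, n)) (D : 'M[C]_(s, p)) : 'M[C]_(n + s, m + p) :=
  block_mx (mpinv A)         (- (mpinv A *m B))
           (C0 *m mpinv A)   (D - C0 *m mpinv A *m B).

(* Complementary transform, relative to D. *)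
Definition cpppt m n s p (A : 'M[C]_(m, n)) (B : 'M[C]_(m, p))
    (C0 : 'M[C]_(s, n)) (D : 'M[C]_(s, p)) : 'M[C]_(m + p, n + s) :=
  block_mx (A - B *m mpinv D *m C0)  (B *m mpinv D)
           (- (mpinv D *m C0))       (mpinv D).

End MoorePenrose.

(* Main.v *)
(** The absorbing property of [(P, Q)] amounts to [R(P) = R(Q)] and
    [R(P^H) = R(Q^H)]: one inclusion of each kind can be read off the equation,
    and equality of ranks gives the other two. The range inclusions on the
    blocks give [R(U) ⊆ R(A) ⊕ R(D)], with the coordinate projections of [R(U)]
    being all of [R(A)] and [R(D)], and the factorisation
    [H = (1, 0; C, 1) diag(A⁺, D) (1, -B; 0, 1)] shows that
    [R(H) = R(A^H) ⊕ R(D)] and [R(H^H) = R(A) ⊕ R(D^H)]; similarly for [J]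
    (here [^H] is the conjugate transpose and [⁺] the Moore-Penrose inverse).
    Column spaces are handled as row spaces of transposes. *)

Require Import Defs.
From mathcomp Require Import all_boot all_order all_algebra.
From mathcomp Require Import reals complex.

Set Implicit Arguments.
Unset Strict Implicit.
Unset Printing Implicit Defensive.

Import Order.TTheory GRing.Theory Num.Theory.
Local Open Scope ring_scope.
Local Open Scope sesquilinear_scope.
Local Open Scope complex_scope.

Section RangeSpaces.
Variable C : numClosedFieldType.

(** * Range inclusions and the Moore-Penrose inverse *)

Lemma mxrange_subP m n p (X : 'M[C]_(m, n)) (Y : 'M[C]_(m, p)) :
  (mxrange X <= mxrange Y)%VS -> (X^T <= Y^T)%MS.
Proof.
move=> /subvP sXY; apply/row_subP => j; rewrite -tr_col.
have /mem_mxrangeP[x ->] : col j X \in mxrange Y.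
  by apply/sXY/mem_mxrangeP; exists (delta_mx j 0); rewrite colE.
by rewrite trmx_mul submxMl.
Qed.

(** Transposing [X^t*] leaves the entrywise conjugate of [X], and conjugation, being a field
    morphism, preserves and reflects row space inclusion. *)
Lemma mxrange_trmxC_subP m n p (X : 'M[C]_(n, m)) (Y : 'M[C]_(p, m)) :
  (mxrange (X^t*) <= mxrange (Y^t*))%VS -> (X <= Y)%MS.
Proof. by move/mxrange_subP; rewrite !map_trmx !trmxK map_submx. Qed.

Lemma mpinvK m n (X : 'M[C]_(m, n)) : mpinv (mpinv X) = X.
Proof.
by apply/esym/mpinv_unique; have /and4P[? ? ? ?] := mpinvP X; apply/and4P.
Qed.

Lemma mpinv_tr m n (X : 'M[C]_(m, n)) : mpinv X^T = (mpinv X)^T.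
Proof.
apply/esym/mpinv_unique.
have /and4P[/eqP X1 /eqP X2 /eqP X3 /eqP X4] := mpinvP X.
apply/and4P; split; apply/eqP; rewrite -?trmx_mul.
- by rewrite mulmxA X1.
- by rewrite mulmxA X2.
- by rewrite -map_trmx X4.
- by rewrite -map_trmx X3.
Qed.

(** [X X⁺] and [Y Y⁺] are the orthogonal projectors onto the two column spaces, so
    [Y Y⁺ X X⁺ = X X⁺]. Taking adjoints gives [X X⁺ Y Y⁺ = X X⁺], whence [X⁺ = X⁺ X X⁺ Y Y⁺] is a
    left multiple of [Y⁺]. *)
Lemma mpinv_sub m n p (X : 'M[C]_(m, n)) (Y : 'M[C]_(m, p)) :
  (X^T <= Y^T)%MS -> (mpinv X <= mpinv Y)%MS.
Proof.
move=> /submxP[Z /(congr1 trmx)]; rewrite trmx_mul !trmxK => XE.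
have /and4P[_ /eqP X2 /eqP X3 _] := mpinvP X.
have /and4P[/eqP Y1 _ /eqP Y3 _] := mpinvP Y.
have YX : Y *m mpinv Y *m (X *m mpinv X) = X *m mpinv X.
  by rewrite {1}XE !mulmxA Y1 -XE.
have XY : X *m mpinv X *m (Y *m mpinv Y) = X *m mpinv X.
  by rewrite -{1}X3 -{1}Y3 -trmxC_mul YX X3.
by rewrite -X2 -mulmxA -XY !mulmxA submxMl.
Qed.

Lemma mpinv_tr_sub m n p (X : 'M[C]_(n, m)) (Y : 'M[C]_(p, m)) :
  (X <= Y)%MS -> ((mpinv X)^T <= (mpinv Y)^T)%MS.
Proof. by rewrite -!mpinv_tr => sXY; apply: mpinv_sub; rewrite !trmxK. Qed.

(** * The absorbing property in terms of row and column spaces *)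

Lemma mp_absorbing_sub m n (P Q : 'M[C]_(m, n)) :
  mp_absorbing P Q -> (Q <= P)%MS /\ (P^T <= Q^T)%MS.
Proof.
rewrite /mp_absorbing mulmxDr mulmxDl => PQ.
(* The expanded equation [P⁺ + Q⁺ = P⁺ P Q⁺ + P⁺ Q Q⁺] is solved for [Q⁺] with [P⁺] factored out on
   the left, then for [P⁺] with [Q⁺] factored out on the right. *)
have QE : mpinv Q = mpinv P *m (P *m mpinv Q + Q *m mpinv Q - 1%:M).
  by rewrite mulmxBr mulmxDr !mulmxA -PQ mulmx1 addrAC subrr add0r.
have PE : mpinv P = (mpinv P *m P + mpinv P *m Q - 1%:M) *m mpinv Q.
  by rewrite mulmxBl mulmxDl -PQ mul1mx addrK.
rewrite -(mpinvK P) -(mpinvK Q); split.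
  by apply: mpinv_sub; rewrite QE trmx_mul submxMl.
by apply: mpinv_tr_sub; rewrite PE submxMl.
Qed.

Lemma mp_absorbing_eqmx m n (P Q : 'M[C]_(m, n)) :
  mp_absorbing P Q -> (P :=: Q)%MS /\ (P^T :=: Q^T)%MS.
Proof.
move=> /mp_absorbing_sub[sQP sPQ].
(* One inclusion concerns rows and the other columns, and they point in opposite directions, so each
   rank bounds the other. *)
have rPQ : \rank P = \rank Q.
  apply/eqP; rewrite eqn_leq (mxrankS sQP) andbT.
  by rewrite -(mxrank_tr P) -(mxrank_tr Q) mxrankS.
split; last by apply/eqmxP; rewrite -(mxrank_leqif_eq sPQ) !mxrank_tr rPQ.
by apply/eqmx_sym/eqmxP; rewrite -(mxrank_leqif_eq sQP) rPQ.
Qed.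

(** The inclusions give [Q⁺ = P⁺ W] and [P⁺ = Z Q⁺] for some [W] and [Z]; hence [P⁺ P Q⁺ = Q⁺] and
    [P⁺ Q Q⁺ = P⁺], and these two identities add up to the claim. *)
Lemma sub_mp_absorbing m n (P Q : 'M[C]_(m, n)) :
  (Q <= P)%MS -> (P^T <= Q^T)%MS -> mp_absorbing P Q.
Proof.
move=> /mpinv_tr_sub/submxP[W /(congr1 trmx)]; rewrite trmx_mul !trmxK => QE.
move=> /mpinv_sub/submxP[Z PE].
have /and4P[_ /eqP P2 _ _] := mpinvP P; have /and4P[_ /eqP Q2 _ _] := mpinvP Q.
rewrite /mp_absorbing mulmxDr mulmxDl addrC; congr (_ + _).
  by rewrite {2}QE mulmxA P2.
by rewrite {2}PE -!mulmxA (mulmxA _ Q) Q2.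
Qed.

(** * Row spaces of block matrices and of the two transforms *)

Section Blocks.
Variables m n s p : nat.
Implicit Types (A : 'M[C]_(m, n)) (B : 'M[C]_(m, p)).
Implicit Types (E : 'M[C]_(s, n)) (D : 'M[C]_(s, p)).

Lemma lsubmx_block_eqmx A B E D :
  (E <= A)%MS -> (lsubmx (block_mx A B E D) :=: A)%MS.
Proof.
move=> sEA; rewrite block_mxEh row_mxKl.
by apply: eqmx_trans (eqmx_sym (addsmxE A E)) _; apply/addsmx_idPl.
Qed.

Lemma rsubmx_block_eqmx A B E D :
  (B <= D)%MS -> (rsubmx (block_mx A B E D) :=: D)%MS.
Proof.
move=> sBD; rewrite block_mxEh row_mxKr.
by apply: eqmx_trans (eqmx_sym (addsmxE B D)) _; apply/addsmx_idPr.
Qed.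

Lemma lsubmxS k l (X : 'M[C]_(k, n + p)) (Y : 'M[C]_(l, n + p)) :
  (X <= Y)%MS -> (lsubmx X <= lsubmx Y)%MS.
Proof. by move=> /submxP[Z ->]; rewrite -mulmx_lsub submxMl. Qed.

Lemma rsubmxS k l (X : 'M[C]_(k, n + p)) (Y : 'M[C]_(l, n + p)) :
  (X <= Y)%MS -> (rsubmx X <= rsubmx Y)%MS.
Proof. by move=> /submxP[Z ->]; rewrite -mulmx_rsub submxMl. Qed.

Lemma block_diag_subP A B E D A' B' E' D' :
    (E <= A)%MS -> (B <= D)%MS -> (E' <= A')%MS -> (B' <= D')%MS ->
    (block_mx A B E D <= block_mx A' B' E' D')%MS ->
  (A <= A')%MS /\ (D <= D')%MS.
Proof.
move=> sE sB sE' sB' sUV; split.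
  have := lsubmxS sUV.
  by rewrite (lsubmx_block_eqmx B D sE) (lsubmx_block_eqmx B' D' sE').
have := rsubmxS sUV.
by rewrite (rsubmx_block_eqmx A E sB) (rsubmx_block_eqmx A' E' sB').
Qed.

(** Writing [B = Z D] moves the right factor [(1, -B; 0, 1)] to the left of [diag(A⁺, D)] as
    [(1, -A⁺ Z; 0, 1)]. All remaining factors then act on the left with determinant 1 and preserve
    the row space. *)
Lemma pppt_eqmx A B E D :
  (B <= D)%MS -> (pppt A B E D :=: block_mx (mpinv A) 0 0 D)%MS.
Proof.
move=> /submxP[Z ->].
have -> : pppt A (Z *m D) E D =
    block_mx 1%:M 0 E 1%:M *m block_mx 1%:M (- (mpinv A *m Z)) 0 1%:M
      *m block_mx (mpinv A) 0 0 D.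
  rewrite /pppt !mulmx_block ?(mulmx0, mul0mx, mul1mx, mulmx1, addr0, add0r).
  by rewrite mulNmx mulmxDl mul1mx mulmxN mulNmx !mulmxA addrC.
apply: eqmxMfull; rewrite row_full_unit unitmx_mul !unitmxE.
by rewrite det_lblock det_ublock !det1 mulr1 unitr1.
Qed.

Lemma cpppt_eqmx A B E D :
  (E <= A)%MS -> (cpppt A B E D :=: block_mx A 0 0 (mpinv D))%MS.
Proof.
move=> /submxP[Z ->].
have -> : cpppt A B (Z *m A) D =
    block_mx 1%:M B 0 1%:M *m block_mx 1%:M 0 (- (mpinv D *m Z)) 1%:M
      *m block_mx A 0 0 (mpinv D).
  rewrite /cpppt !mulmx_block ?(mulmx0, mul0mx, mul1mx, mulmx1, addr0, add0r).
  by rewrite mulNmx mulmxDl mul1mx mulmxN mulNmx !mulmxA.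
apply: eqmxMfull; rewrite row_full_unit unitmx_mul !unitmxE.
by rewrite det_lblock det_ublock !det1 mulr1 unitr1.
Qed.

End Blocks.

Lemma block_diagS m m' n s s' p (X : 'M[C]_(m, n)) (X' : 'M[C]_(m', n))
    (Y : 'M[C]_(s, p)) (Y' : 'M[C]_(s', p)) :
  (X <= X')%MS -> (Y <= Y')%MS ->
  (block_mx X 0 0 Y <= block_mx X' 0 0 Y')%MS.
Proof.
move=> /submxP[Z ->] /submxP[W ->].
apply/submxP; exists (block_mx Z 0 0 W).
by rewrite mulmx_block !(mulmx0, mul0mx, addr0, add0r).
Qed.

(** This reduces column spaces of the transform to [pppt_eqmx]. Transposition moves the minus sign
    to the other off-diagonal block, which negating both off-diagonal arguments corrects. *)
Lemma pppt_tr m n s p (A : 'M[C]_(m, n)) (B : 'M[C]_(m, p))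
    (E : 'M[C]_(s, n)) (D : 'M[C]_(s, p)) :
  (pppt A B E D)^T = pppt A^T (- E^T) (- B^T) D^T.
Proof.
rewrite /pppt tr_block_mx !mpinv_tr mulmxN !mulNmx mulmxN !opprK.
by rewrite !linearB !linearN /= !trmx_mul mulmxA.
Qed.

Lemma cpppt_tr m n s p (A : 'M[C]_(m, n)) (B : 'M[C]_(m, p))
    (E : 'M[C]_(s, n)) (D : 'M[C]_(s, p)) :
  (cpppt A B E D)^T = cpppt A^T (- E^T) (- B^T) D^T.
Proof.
rewrite /cpppt tr_block_mx !mpinv_tr mulmxN !mulNmx mulmxN !opprK.
by rewrite !linearB !linearN /= !trmx_mul mulmxA.
Qed.

(** * Transfer of the absorbing property to the transforms *)

Section Transforms.
Variables m n s p : nat.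
Variables (A_U A_V : 'M[C]_(m, n)) (B_U B_V : 'M[C]_(m, p)).
Variables (C_U C_V : 'M[C]_(s, n)) (D_U D_V : 'M[C]_(s, p)).
Hypotheses (sCAU : (C_U <= A_U)%MS) (sBAU : (B_U^T <= A_U^T)%MS).
Hypotheses (sBDU : (B_U <= D_U)%MS) (sCDU : (C_U^T <= D_U^T)%MS).
Hypotheses (sCAV : (C_V <= A_V)%MS) (sBAV : (B_V^T <= A_V^T)%MS).
Hypotheses (sBDV : (B_V <= D_V)%MS) (sCDV : (C_V^T <= D_V^T)%MS).
Hypothesis absUV :
  mp_absorbing (block_mx A_U B_U C_U D_U) (block_mx A_V B_V C_V D_V).

Let eqUV := (mp_absorbing_eqmx absUV).1.

Let eqUVT :
  (block_mx A_U^T C_U^T B_U^T D_U^T :=: block_mx A_V^T C_V^T B_V^T D_V^T)%MS.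
Proof. by rewrite -!tr_block_mx; apply: (mp_absorbing_eqmx absUV).2. Qed.

Let sUV : (A_U <= A_V)%MS /\ (D_U <= D_V)%MS.
Proof. by apply: (block_diag_subP sCAU sBDU sCAV sBDV); rewrite eqUV. Qed.

Let sVU : (A_V <= A_U)%MS /\ (D_V <= D_U)%MS.
Proof. by apply: (block_diag_subP sCAV sBDV sCAU sBDU); rewrite eqUV. Qed.

Let sUVT : (A_U^T <= A_V^T)%MS /\ (D_U^T <= D_V^T)%MS.
Proof. by apply: (block_diag_subP sBAU sCDU sBAV sCDV); rewrite eqUVT. Qed.

Let sVUT : (A_V^T <= A_U^T)%MS /\ (D_V^T <= D_U^T)%MS.
Proof. by apply: (block_diag_subP sBAV sCDV sBAU sCDU); rewrite eqUVT. Qed.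

Let oppS k l q (X : 'M[C]_(k, q)) (Y : 'M[C]_(l, q)) :
  (X <= Y)%MS -> (- X <= Y)%MS.
Proof. by rewrite eqmx_opp. Qed.

(** The Moore-Penrose inverse exchanges row and column spaces: comparing rows of the transforms uses
    the columns of the [A] blocks but the rows of the [D] blocks, and comparing columns does the
    reverse. *)
Lemma mp_absorbing_pppt :
  mp_absorbing (pppt A_U B_U C_U D_U) (pppt A_V B_V C_V D_V).
Proof.
apply: sub_mp_absorbing.
  rewrite (pppt_eqmx A_V C_V sBDV) (pppt_eqmx A_U C_U sBDU).
  by apply: block_diagS sVU.2; apply: mpinv_sub sVUT.1.
rewrite !pppt_tr (pppt_eqmx _ _ (oppS sCDU)) (pppt_eqmx _ _ (oppS sCDV)).
by apply: block_diagS sUVT.2; apply: mpinv_sub; rewrite !trmxK; apply: sUV.1.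
Qed.

Lemma mp_absorbing_cpppt :
  mp_absorbing (cpppt A_U B_U C_U D_U) (cpppt A_V B_V C_V D_V).
Proof.
apply: sub_mp_absorbing.
  rewrite (cpppt_eqmx B_V D_V sCAV) (cpppt_eqmx B_U D_U sCAU).
  by apply: block_diagS sVU.1 _; apply: mpinv_sub sVUT.2.
rewrite !cpppt_tr (cpppt_eqmx _ _ (oppS sBAU)) (cpppt_eqmx _ _ (oppS sBAV)).
by apply: block_diagS sUVT.1 _; apply: mpinv_sub; rewrite !trmxK; apply: sUV.2.
Qed.

End Transforms.

End RangeSpaces.

Theorem theorem5p3 (R : realType) (m n s p : nat)
    (A_U A_V : 'M[R[i]]_(m, n)) (B_U B_V : 'M[R[i]]_(m, p))
    (C_U C_V : 'M[R[i]]_(s, n)) (D_U D_V : 'M[R[i]]_(s, p))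
    (hCAU : (mxrange (C_U^t*) <= mxrange (A_U^t*))%VS)
    (hBAU : (mxrange B_U <= mxrange A_U)%VS)
    (hBDU : (mxrange (B_U^t*) <= mxrange (D_U^t*))%VS)
    (hCDU : (mxrange C_U <= mxrange D_U)%VS)
    (hCAV : (mxrange (C_V^t*) <= mxrange (A_V^t*))%VS)
    (hBAV : (mxrange B_V <= mxrange A_V)%VS)
    (hBDV : (mxrange (B_V^t*) <= mxrange (D_V^t*))%VS)
    (hCDV : (mxrange C_V <= mxrange D_V)%VS) :
  let U := block_mx A_U B_U C_U D_U in
  let V := block_mx A_V B_V C_V D_V in
  (forall sqA : n = m,
     range_symmetric (castmx (erefl m, sqA) A_U) ->
     range_symmetric (castmx (erefl m, sqA) A_V) ->
     mp_absorbing U V ->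
     mp_absorbing (pppt A_U B_U C_U D_U) (pppt A_V B_V C_V D_V))
  /\
  (forall sqD : p = s,
     range_symmetric (castmx (erefl s, sqD) D_U) ->
     range_symmetric (castmx (erefl s, sqD) D_V) ->
     mp_absorbing U V ->
     mp_absorbing (cpppt A_U B_U C_U D_U) (cpppt A_V B_V C_V D_V)).
Proof.
move=> U V; move: hCAU hBAU hBDU hCDU => /mxrange_trmxC_subP sCAU
  /mxrange_subP sBAU /mxrange_trmxC_subP sBDU /mxrange_subP sCDU.
move: hCAV hBAV hBDV hCDV => /mxrange_trmxC_subP sCAV
  /mxrange_subP sBAV /mxrange_trmxC_subP sBDV /mxrange_subP sCDV.
split=> _ _ _ absUV.
- exact: (mp_absorbing_pppt sCAU sBAU sBDU sCDU sCAV sBAV sBDV sCDV absUV).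
- exact: (mp_absorbing_cpppt sCAU sBAU sBDU sCDU sCAV sBAV sBDV sCDV absUV).
Qed.
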